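(* Let $k\geq 3$ and let $\varepsilon>0$ be a fixed real. Suppose $k\leq c=2m/n\leq c_k'-\varepsilon$. Let $\phi(n)=o(1)$, and let $\mathbf{d}\in\mathcal{D}_k(n,m)$ satisfy $D_k(\mathbf{d})\geq\mathbb{E}[D_k(\mathbf{Y})](1-\phi(n))$, where $\mathbf{Y}=(Y_1,\dots,Y_n)$ with the $Y_i$ independent truncated Poisson variables with parameters $(k,\lambda_{k,c})$. Then there is a constant $\varepsilon'>0$ (depending on $\varepsilon$) such that for every function $h(n)\to\infty$, asymptotically almost surely $W(G_M(\mathbf{d}))\leq h(n)$ or $W(G_M(\mathbf{d}))\geq\varepsilon' n$. Moreover, $W(G_M(\mathbf{d}))\geq\varepsilon' n$ with probability bounded away from zero.
   Context: $\mathcal{D}_k(n,m)$ is the set of $\mathbf{d}\in\mathbb{N}^n$ with $\sum_i d_i=2m$ and $\min_i d_i\geq k$; $D_j(\mathbf{d})$ is the number of coordinates of $\mathbf{d}$ equal to $j$. $G_M(\mathbf{d})$ is the pairing-model random multigraph: partition $[2m]$ into bins of sizes $d_1,\dots,d_n$, take a uniformly random perfect matching on $[2m]$, and contract each bin to a vertex. The $k$-core $K(H)$ of a multigraph $H$ is its maximal submultigraph of minimum degree at least $k$; $W(H)=|V(H)|-|V(K(H-e))|$ with $e$ a uniformly random edge of $H$. With $f_k(\lambda)=e^\lambda-\sum_{i=0}^{k-1}\lambda^i/i!$, a truncated Poisson variable with parameters $(k,\lambda)$ takes value $j\geq k$ with probability $\lambda^j/(j!f_k(\lambda))$; $\lambda_{k,c}$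 is the positive root of $\lambda f_{k-1}(\lambda)/f_k(\lambda)=c$. With $h_k(\mu)=e^\mu\mu/f_{k-1}(\mu)$, $\mu_{k,c_k}$ is the unique minimizer of $h_k$ on $(0,\infty)$ and $c_k'=\mu_{k,c_k}f_{k-1}(\mu_{k,c_k})/f_k(\mu_{k,c_k})$. Asymptotically almost surely means with probability tending to $1$ as $n\to\infty$. *)

(* Defs.v *)
From HB Require Import structures.
From mathcomp Require Import all_boot all_order all_algebra.
From mathcomp Require Import all_classical all_reals all_analysis.

Set Implicit Arguments.
Unset Strict Implicit.
Unset Printing Implicit Defensive.

Import Order.TTheory GRing.Theory Num.Theory.
Import numFieldNormedType.Exports.

Local Open Scope classical_set_scope.
Local Open Scope ring_scope.

Section Multigraph.

(* Multigraphs, with loops and multiple edges, have vertices in V and edges in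
   E; [ends e v] is the number of the two ends of the edge e that are attached
   to the vertex v (so it is 2 when e is a loop at v, and a loop counts twice
   in a degree).  A multigraph is a pair (vertex set, edge set), and all the
   submultigraphs of a multigraph share its function [ends]. *)
Variables (V E : finType) (ends : E -> V -> nat).
Implicit Types H K : {set V} * {set E}.

Definition multigraph H : bool :=
  [forall e in H.2, forall v, (0 < ends e v)%N ==> (v \in H.1)].

Definition submultigraph K H : bool :=
  [&& multigraph K, K.1 \subset H.1 & K.2 \subset H.2].

Definition degree H (v : V) : nat := (\sum_(e in H.2) ends e v)%N.

Definition min_degree_ge (k : nat) H : bool :=
  [forall v in H.1, (k <= degree H v)%N].

Definition is_kcore (k : nat) H K : bool :=
  [&& submultigraph K H, min_degree_ge k K &
   [forall K', submultigraph K' H && min_degree_ge k K' &&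
               submultigraph K K' ==> (K' == K)]].

(* The default value is never used: see [kcoreP]. *)
Definition kcore (k : nat) H : {set V} * {set E} :=
  odflt (finset.set0, finset.set0) [pick K | is_kcore k H K].

Definition del_edge H (e : E) : {set V} * {set E} := (H.1, H.2 :\ e).

Definition lost_vertices (k : nat) H (e : E) : nat :=
  (#|H.1| - #|(kcore k (del_edge H e)).1|)%N.

Let good k H K := submultigraph K H && min_degree_ge k K.

Let goodU k H K K' : good k H K -> good k H K' ->
  good k H (K.1 :|: K'.1, K.2 :|: K'.2).
Proof.
case/andP=> /and3P[/forall_inP m1 v1 e1] /forall_inP d1.
case/andP=> /and3P[/forall_inP m2 v2 e2] /forall_inP d2.
have degS (A B : {set E}) v : A \subset B ->
  (\sum_(e in A) ends e v <= \sum_(e in B) ends e v)%N.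
  move=> sAB; rewrite [leqRHS](big_setID A) /= (finset.setIidPr sAB).
  exact: leq_addr.
apply/andP; split; last first.
  apply/forall_inP => v; rewrite inE => /orP[/d1|/d2] /leq_trans; apply;
    by apply: degS; rewrite (finset.subsetUl, finset.subsetUr).
rewrite /submultigraph /= !finset.subUset v1 v2 e1 e2 !andbT.
apply/forall_inP => e; rewrite inE => /orP[/m1|/m2] /forallP h;
  apply/forallP => v; apply/implyP => /(implyP (h v)); rewrite inE => ->//.
by rewrite orbT.
Qed.

(* The k-core is the largest submultigraph of minimum degree at least k. *)
Lemma kcoreP k H : is_kcore k H (kcore k H) /\
  (forall K, submultigraph K H -> min_degree_ge k K ->
     submultigraph K (kcore k H)).
Proof.
have good0 : good k H (finset.set0, finset.set0).
  rewrite /good /submultigraph /= !finset.sub0set !andbT.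
  by apply/andP; split; apply/forall_inP => e; rewrite inE.
pose sz K := (#|K.1| + #|K.2|)%N.
case: (arg_maxnP sz good0) => K gK Kmax.
have KP : is_kcore k H K.
  case/andP: (gK) => s d; apply/and3P; split=> //.
  apply/forallP => K'; apply/implyP => /andP[gK'].
  case/and3P=> _ sV sE.
  have le : (#|K'.1| + #|K'.2| <= #|K.1| + #|K.2|)%N := Kmax _ gK'.
  have cV := subset_leq_card sV; have cE := subset_leq_card sE.
  have eV : K.1 = K'.1.
    apply/eqP; rewrite finset.eqEcard sV /= leqNgt; apply/negP => lt.
    by have := leq_add lt cE; rewrite addSn ltnNge le.
  have eE : K.2 = K'.2.
    apply/eqP; rewrite finset.eqEcard sE /= leqNgt; apply/negP => lt.
    by have := leq_add cV lt; rewrite addnS ltnNge le.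
  by move: eV eE; case: (K) (K') => [? ?] [? ?] /= -> ->.
have cP : is_kcore k H (kcore k H).
  by rewrite /kcore; case: pickP => [//|/(_ K)]; rewrite KP.
split=> // L sL dL; case/and3P: cP => sC dC /forallP mC.
set C := kcore k H in sC dC mC *.
have gU : good k H (L.1 :|: C.1, L.2 :|: C.2).
  by apply: goodU; apply/andP.
have := mC (L.1 :|: C.1, L.2 :|: C.2).
rewrite -/(good k H _) gU /= /submultigraph /= !finset.subsetUr !andbT.
case/and3P: sC => -> _ _ /= /eqP eC.
case/and3P: sL => -> _ _ /=.
by rewrite -{1}eC -eC /= !finset.subsetUl.
Qed.

End Multigraph.

Section PairingModel.

(* The points 1, ..., 2m are the elements of the disjoint union of the bins,
   the bin of the vertex i having size d i. *)
Variables (n : nat) (d : 'I_n -> nat).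

Definition point : finType := {i : 'I_n & 'I_(d i)}.

Definition bin (i : 'I_n) : {set point} := [set p : point | tag p == i]%SET.

Definition perfect_matchings : {set {set {set point}}} :=
  [set M : {set {set point}} |
     finset.partition M [set: point]%SET && [forall e in M, #|e| == 2%N]]%SET.

(* The multigraph obtained by contracting the bins: its edges are the pairs of
   the matching M, and its vertices are the bins. *)
Definition pair_ends (e : {set point}) (i : 'I_n) : nat := #|e :&: bin i|.

Definition contraction (M : {set {set point}}) : {set 'I_n} * {set {set point}} :=
  ([set: 'I_n]%SET, M).

Lemma card_bin i : #|bin i| = d i.
Proof.
have -> : bin i = [set (Tagged (fun j => 'I_(d j)) x : point) | x : 'I_(d i)]%SET.
  apply/setP => -[j x]; rewrite inE /=; apply/eqP/imsetP => [ji|[y _ []//]].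
  by case: _ / ji in x *; exists x.
by rewrite card_imset ?card_ord// => x y /eqP; rewrite eq_Tagged => /eqP.
Qed.

Lemma sum_pair_ends M e : M \in perfect_matchings -> e \in M ->
  (\sum_i pair_ends e i = 2)%N.
Proof.
rewrite inE => /andP[_ /forall_inP M2] /M2/eqP <-.
rewrite -[RHS]sum1_card (partition_big (@tag _ _) xpredT)//=.
apply: eq_bigr => i _; rewrite /pair_ends -sum1_card.
by apply: eq_bigl => p; rewrite !inE.
Qed.

Lemma degree_contraction M i : M \in perfect_matchings ->
  degree pair_ends (contraction M) i = d i.
Proof.
rewrite inE => /andP[/and3P[/eqP cM tM _] _]; rewrite -card_bin -sum1_card.
rewrite (eq_bigl (fun p => (p \in finset.cover M) && (p \in bin i))); last first.
  by move=> p; rewrite cM finset.in_setT.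
rewrite big_trivIset_cond //= /degree /=; apply: eq_bigr => e _.
by rewrite /pair_ends -sum1_card; apply: eq_bigl => p; rewrite inE.
Qed.

End PairingModel.

Section Definitions.

Variable R : realType.

Definition unif_mean (T : finType) (A : {set T}) (f : T -> R) : R :=
  (\sum_(x in A) f x) / #|A|%:R.

(* Probability that W(G_M(d)) satisfies Q: the matching is uniformly random,
   then the deleted edge is uniformly random in the resulting multigraph. *)
Definition prob_W (k n : nat) (d : 'I_n -> nat) (Q : pred nat) : R :=
  unif_mean (perfect_matchings d) (fun M =>
    unif_mean (contraction M).2 (fun e =>
      (Q (lost_vertices (@pair_ends n d) k (contraction M) e))%:R)).

Definition degree_seq (k n m : nat) (d : 'I_n -> nat) : Prop :=
  (\sum_i d i = 2 * m)%N /\ forall i, (k <= d i)%N.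

Definition num_deg (j n : nat) (d : 'I_n -> nat) : nat := #|[set i | d i == j]%SET|.

Definition avg_deg (n m : nat) : R := (2 * m)%:R / n%:R.

Definition f_ (k : nat) (x : R) : R := expR x - \sum_(i < k) x ^+ i / i`!%:R.

(* For c = k there is no positive root; the value is then 0, the limit of the
   root as c decreases to k. *)
Definition lambda (k : nat) (c : R) : R :=
  xget 0 [set x | 0 < x /\ x * f_ k.-1 x / f_ k x = c].

(* For parameter 0 this is the limiting law, the point mass at k. *)
Definition trunc_poisson_pmf (k : nat) (x : R) (j : nat) : R :=
  if x == 0 then (j == k)%:R
  else if (k <= j)%N then x ^+ j / (j`!%:R * f_ k x) else 0.

Definition h_ (k : nat) (x : R) : R := expR x * x / f_ k.-1 x.

Definition mu_ck (k : nat) : R :=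
  xget 0 [set x | 0 < x /\ forall y, 0 < y -> h_ k x <= h_ k y].

Definition ck' (k : nat) : R := mu_ck k * f_ k.-1 (mu_ck k) / f_ k (mu_ck k).

Definition mutually_independent disp (Omega : measurableType disp)
    (P : probability Omega R) (n : nat) (Y : 'I_n -> {RV P >-> nat}) : Prop :=
  forall (J : {set 'I_n}) (A : 'I_n -> set nat),
    P (\bigcap_(i in [set i | i \in J]) (Y i @^-1` A i)) =
    (\prod_(i in J) P (Y i @^-1` A i))%E.

Definition iid_trunc_poisson disp (Omega : measurableType disp)
    (P : probability Omega R) (n : nat) (Y : 'I_n -> {RV P >-> nat})
    (k : nat) (x : R) : Prop :=
  mutually_independent Y /\
  forall i j, P (Y i @^-1` [set j]) = (trunc_poisson_pmf k x j)%:E.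

End Definitions.

(* Main.v *)
Require Import Defs.
From HB Require Import structures.
From mathcomp Require Import all_boot all_order all_algebra.
From mathcomp Require Import zify ring lra.
From mathcomp Require Import reals.

(** Strip the multigraph one pair at a time: let U be the set of unmatched points,
    call a vertex deficient when fewer than k of its points are in U, and pending
    a point of U in a deficient vertex.  Deficient vertices are outside the core,
    so revealing the partner of a pending point and deleting that pair does not
    change the core; when no point is pending, the core consists of the
    nondeficient vertices, and W is the number of deficient ones.  The partner is
    uniform on the other points of U.  A partner in a vertex with exactly k
    remaining points turns k - 1 points into pending ones, so, as long as at most
    epsilon n points have been revealed, the number L of pending points has
    positive drift as soon as (k - 1) k D_k > (1 + delta) 2 m.
    Then E[theta^L] decreases by a factor rho < 1 at each step for some theta < 1,
    hence extinction after step T but before step epsilon n has probability at most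
    rho^T, and extinction before step epsilon n has probability at most theta^L for
    the initial L, which is positive with probability at least 1 / (k - 1).

    The bound on D_k comes from c'_k: the minimizer mu of h_k satisfies
    f_(k-1)(mu) = mu^(k-1) / (k-2)!, so c'_k = k (k-1) Pr[Y = k] for Y truncated
    Poisson with parameters (k, mu).  Since E[Y] increases and Pr[Y = k] decreases
    with the parameter, c <= c'_k - eps gives k (k-1) Pr[Y = k] >= c'_k >= c + eps
    at the parameter lambda_(k,c). *)

Set Implicit Arguments.
Unset Strict Implicit.
Unset Printing Implicit Defensive.

Import Order.TTheory GRing.Theory Num.Theory.

(** * Cores and matchings *)

Section KCore.

Variables (V E : finType) (ends : E -> V -> nat) (k : nat).
Implicit Types H K : {set V} * {set E}.

Local Notation sub := (submultigraph ends).
Local Notation core := (kcore ends k).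
Local Notation deg := (degree ends).

Lemma kcore_sub H : sub (core H) H.
Proof. by case: (kcoreP ends k H) => /and3P[]. Qed.

Lemma kcore_min_degree H : min_degree_ge ends k (core H).
Proof. by case: (kcoreP ends k H) => /and3P[]. Qed.

Lemma kcore_max H K : sub K H -> min_degree_ge ends k K -> sub K (core H).
Proof. by case: (kcoreP ends k H) => _; apply. Qed.

Lemma degreeS H K v : K.2 \subset H.2 -> deg K v <= deg H v.
Proof.
move=> sKH; rewrite /degree [leqRHS](big_setID K.2) /= (setIidPr sKH).
exact: leq_addr.
Qed.

Lemma kcore_low_degree H v : deg H v < k -> v \notin (core H).1.
Proof.
move=> ltk; apply/negP => vC.
have /forall_inP/(_ v vC) := kcore_min_degree H.
have /and3P[_ _ /degreeS leH] := kcore_sub H.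
by move=> /leq_trans/(_ (leH v)); rewrite leqNgt ltk.
Qed.

(** The vertex [v] is outside the core of [H], so [e] is not an edge of that core, which thus
    survives in [del_edge H e]. Maximality gives both inclusions. *)
Lemma kcore_del_edge H e v : deg H v < k -> 0 < ends e v ->
  (core (del_edge H e)).1 = (core H).1.
Proof.
move=> ltk ev; apply/eqP; rewrite eqEsubset.
have /and3P[mC' C'1 C'2] := kcore_sub (del_edge H e).
have /and3P[mC C1 C2] := kcore_sub H.
apply/andP; split.
  have : sub (core (del_edge H e)) H.
    by apply/and3P; split=> //; apply: subset_trans C'2 (subsetDl _ _).
  by move=> /kcore_max/(_ (kcore_min_degree _))/and3P[].
have : sub (core H) (del_edge H e).
  apply/and3P; split=> //=; rewrite subsetD1 C2 /=.
  apply: contra (kcore_low_degree ltk) => eC.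
  by move/forall_inP: mC => /(_ e eC)/forallP/(_ v)/implyP; apply.
by move=> /kcore_max/(_ (kcore_min_degree _))/and3P[].
Qed.

End KCore.

(** * Uniform matchings and deferred decisions *)

Section Matchings.

Variable T : finType.
Implicit Types (U e : {set T}) (M : {set {set T}}).

(** Stripping needs matchings of arbitrary sets [U]; [perfect_matchings d] is convertible to the
    case where [U] is the set of all points. *)
Definition matchings U : {set {set {set T}}} :=
  [set M : {set {set T}} | partition M U && [forall e in M, #|e| == 2]].

Lemma matchingsP U M :
  reflect (partition M U /\ {in M, forall e, #|e| = 2}) (M \in matchings U).
Proof.
rewrite inE; apply: (iffP andP) => -[pM M2]; split=> //.
  by move=> e eM; apply/eqP/(forall_inP M2).
by apply/forall_inP => e /M2 ->.
Qed.

Lemma matchings_del U M e :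
  M \in matchings U -> e \in M -> M :\ e \in matchings (U :\: e).
Proof.
move=> /matchingsP[pM M2] eM; apply/matchingsP; split; first exact: partitionD1.
by move=> e' /setD1P[_ /M2].
Qed.

Lemma matchings_notin U M e : #|e| = 2 -> M \in matchings (U :\: e) -> e \notin M.
Proof.
move=> e2 /matchingsP[pM _]; apply/negP => /(partitionS pM).
rewrite subsetD => /andP[_]; rewrite -setI_eq0 setIid => /eqP e0.
by rewrite e0 cards0 in e2.
Qed.

Lemma matchings_add U M e : e \subset U -> #|e| = 2 ->
  M \in matchings (U :\: e) -> e |: M \in matchings U.
Proof.
move=> eU e2 /matchingsP[pM M2]; apply/matchingsP; split; last first.
  by move=> e' /setU1P[->|/M2].
rewrite -[in X in partition _ X](setID U e) (setIidPr eU).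
apply: partitionU1 => //; first by rewrite -card_gt0 e2.
by rewrite -setI_eq0 setIDA setDIl setDv set0I.
Qed.

Lemma sum_matchings_edge (R : nmodType) U e (F : {set {set T}} -> R) :
  e \subset U -> #|e| = 2 ->
  (\sum_(M in matchings U | e \in M) F M =
   \sum_(M in matchings (U :\: e)) F (e |: M))%R.
Proof.
move=> eU e2.
rewrite (reindex_onto (fun M => e |: M) (fun M => M :\ e)) /=; last first.
  by move=> M /andP[_ eM]; rewrite setD1K.
apply: eq_bigl => M; rewrite setU11 andbT; apply/andP/idP => [[eM /eqP defM]|UM].
  by rewrite -defM; apply: matchings_del; rewrite ?setU11.
by rewrite matchings_add // setU1K // (matchings_notin e2 UM).
Qed.

(** Given the deleted pair [e], the rest of a uniform matching is a uniform matching of [U :\: e],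
    from which stripping starts. *)
Lemma sum_matchings_edges (R : nmodType) U (F : {set T} -> {set {set T}} -> R) :
  (\sum_(M in matchings U) \sum_(e in M) F e (M :\ e) =
   \sum_(e : {set T} | (e \subset U) && (#|e| == 2))
     \sum_(M in matchings (U :\: e)) F e M)%R.
Proof.
rewrite (exchange_big_dep [pred e : {set T} | (e \subset U) && (#|e| == 2)]) /=.
  apply: eq_bigr => e /andP[eU /eqP e2]; rewrite sum_matchings_edge //.
  by apply: eq_bigr => M UM; rewrite setU1K // (matchings_notin e2 UM).
by move=> M e /matchingsP[pM M2] eM; rewrite (partitionS pM eM) M2.
Qed.

Lemma matchings_partner U M p : M \in matchings U -> p \in U ->
  exists2 q, q \in U :\ p & forall r, r \in U :\ p -> ([set p; r] \in M) = (r == q).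
Proof.
move=> /matchingsP[pM M2] pU; have cM := cover_partition pM.
have tM := partition_trivIset pM.
have bM : pblock M p \in M by rewrite pblock_mem ?cM.
have pb : p \in pblock M p by rewrite mem_pblock cM.
have [q defb] : exists q, pblock M p :\ p = [set q].
  by apply/cards1P; rewrite -eqSS -(M2 _ bM) (cardsD1 p (pblock M p)) pb.
have : q \in pblock M p :\ p by rewrite defb set11.
case/setD1P => qp qb; exists q.
  by rewrite in_setD1 qp (subsetP (partitionS pM bM)).
move=> r /setD1P[rp rU]; apply/idP/eqP => [rM|->].
  have := def_pblock tM rM (set21 p r) => e.
  by apply/set1P; rewrite -defb e in_setD1 rp set22.
by have := setD1K pb; rewrite defb => ->.
Qed.

(** Matchings are sorted by the partner [q] of [p]; by [card_matchings] all classes have the same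
    size, so the partner is uniform. *)
Lemma sum_matchings_point (R : nmodType) U p (F : {set {set T}} -> R) : p \in U ->
  (\sum_(M in matchings U) F M =
   \sum_(q in U :\ p) \sum_(M in matchings (U :\: [set p; q])) F ([set p; q] |: M))%R.
Proof.
move=> pU.
under [RHS]eq_bigr => q /setD1P[qp qU].
  rewrite -sum_matchings_edge ?cards2 1?eq_sym ?qp //; first over.
  by apply/subsetP => x /set2P[]->.
rewrite (exchange_big_dep (mem (matchings U))) /=; last by move=> ? ? _ /andP[].
apply: eq_bigr => M UM; have [q qU partner] := matchings_partner UM pU.
rewrite (bigD1 q) ?qU ?UM ?partner //= big1 ?addr0 //.
by move=> r /andP[/andP[rU]]; rewrite partner // => ->.
Qed.

Lemma card_pair_del U p q : p \in U -> q \in U :\ p ->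
  #|U| = #|U :\: [set p; q]|.+2.
Proof.
move=> pU /setD1P[qp qU]; rewrite (cardsD1 p) pU (cardsD1 q) in_setD1 qp qU.
by rewrite setDDl.
Qed.

Lemma card_matchings j U : #|U| = j.*2 -> #|matchings U| = \prod_(i < j) i.*2.+1.
Proof.
elim: j U => [|j IH] U.
  move=> /eqP; rewrite cards_eq0 big_ord0 => /eqP ->; apply/eqP/cards1P.
  exists set0; apply/setP => M; rewrite !inE partition_set0.
  by case: eqP => // ->; apply/forall_inP => e; rewrite inE.
move=> U2; have [p pU] : exists p, p \in U by apply/card_gt0P; rewrite U2.
have -> : #|matchings U| = \sum_(q in U :\ p) #|matchings (U :\: [set p; q])|.
  rewrite -sum1_card [LHS](sum_matchings_point (fun=> 1) pU).
  by apply: eq_bigr => q _; rewrite -sum1_card.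
rewrite (eq_bigr (fun=> \prod_(i < j) i.*2.+1)); last first.
  by move=> q qU; rewrite IH //; move: U2; rewrite (card_pair_del pU qU); lia.
rewrite sum_nat_const big_ord_recr /= mulnC; congr (_ * _).
by move: U2; rewrite (cardsD1 p) pU; lia.
Qed.

Lemma card_matching U M : M \in matchings U -> #|U| = #|M|.*2.
Proof.
move=> /matchingsP[pM M2].
by rewrite (card_uniform_partition M2 pM) muln2.
Qed.

End Matchings.

(** * The stripping process *)

Section Stripping.

Variables (n : nat) (d : 'I_n -> nat) (k : nat).
Local Notation point := (point d).
Local Notation bin := (bin d).
Implicit Types (U Z : {set point}) (M : {set {set point}}).

Definition deficient U : {set 'I_n} := [set v | #|U :&: bin v| < k].

Definition pending U : {set point} := [set p in U | tag p \in deficient U].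

(* [lost (M :\ e)] is convertible to [lost_vertices] of [contraction M] and [e]. *)
Definition lost M : nat :=
  #|[set: 'I_n]| - #|(kcore (@pair_ends n d) k ([set: 'I_n], M)).1|.

Lemma mem_bin (p : point) v : (p \in bin v) = (tag p == v).
Proof. by rewrite inE. Qed.

Lemma card_tag U (Q : pred 'I_n) :
  #|[set p in U | Q (tag p)]| = \sum_(v | Q v) #|U :&: bin v|.
Proof.
rewrite -sum1_card (partition_big (fun p : point => tag p) Q) /=; last first.
  by move=> p; rewrite inE => /andP[].
apply: eq_bigr => v Qv; rewrite -sum1_card; apply: eq_bigl => p.
by rewrite !inE andbAC; case: eqP => [->|]; rewrite ?Qv ?andbF ?andbT.
Qed.

Lemma card_pending U : #|pending U| = \sum_(v in deficient U) #|U :&: bin v|.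
Proof. exact: card_tag. Qed.

Lemma pending_le U : #|pending U| <= k.-1 * #|deficient U|.
Proof.
rewrite card_pending mulnC -sum_nat_const; apply: leq_sum => v.
by rewrite inE; case: k.
Qed.

Lemma deficientS U Z : Z \subset U -> deficient U \subset deficient Z.
Proof.
move=> ZU; apply/subsetP => v; rewrite !inE; apply: leq_ltn_trans.
by apply: subset_leq_card; apply: setSI.
Qed.

Lemma degree_matching U M v (A : {set 'I_n}) : M \in matchings U ->
  degree (@pair_ends n d) (A, M) v = #|U :&: bin v|.
Proof.
move=> /matchingsP[pM _]; rewrite -sum1_card.
rewrite (eq_bigl (fun p => (p \in U) && (p \in bin v))); last by move=> p; rewrite inE.
rewrite (set_partition_big_cond _ pM) /degree /=; apply: eq_bigr => e _.
by rewrite /pair_ends -sum1_card; apply: eq_bigl => p; rewrite inE.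
Qed.

Lemma lost_pending U M e p : M \in matchings U -> e \in M -> p \in e ->
  p \in pending U -> lost (M :\ e) = lost M.
Proof.
move=> UM eM pe; rewrite inE => /andP[pU]; rewrite inE => ltk.
rewrite /lost -(kcore_del_edge (H := ([set: 'I_n], M)) (e := e) (v := tag p)) //.
  by rewrite (degree_matching _ _ UM).
by rewrite card_gt0; apply/set0Pn; exists p; rewrite inE pe mem_bin eqxx.
Qed.

Lemma kcore_deficient U M : M \in matchings U ->
  (kcore (@pair_ends n d) k ([set: 'I_n], M)).1 \subset ~: deficient U.
Proof.
move=> UM; apply/subsetP => v; rewrite inE; apply: contraL; rewrite inE => ltk.
by apply: kcore_low_degree; rewrite (degree_matching _ _ UM).
Qed.

Lemma lost_ge U M : M \in matchings U -> #|deficient U| <= lost M.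
Proof.
move=> /kcore_deficient/subset_leq_card; rewrite [leqRHS]cardsCs setCK /lost cardsT.
have : #|deficient U| <= n by rewrite -[leqRHS]card_ord max_card.
by rewrite card_ord; move: #|deficient U| #|(kcore _ _ _).1|; lia.
Qed.

(** With nothing pending, all pairs join nondeficient vertices, which together with [M] form a
    submultigraph of minimum degree at least [k], hence lie in the core. *)
Lemma lost_stop U M : M \in matchings U -> pending U = set0 ->
  lost M = #|deficient U|.
Proof.
move=> UM U0; have /matchingsP[pM _] := UM.
have /and3P[_ + _] : submultigraph (@pair_ends n d) (~: deficient U, M)
    (kcore (@pair_ends n d) k ([set: 'I_n], M)).
  apply: kcore_max.
    rewrite /submultigraph subsetT subxx !andbT.
    apply/forall_inP => e eM; apply/forallP => v; apply/implyP.
    rewrite card_gt0 => /set0Pn[p]; rewrite inE mem_bin => /andP[pe /eqP <-].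
    have pU : p \in U by apply: (subsetP (partitionS pM eM)).
    by rewrite inE; apply/negP => defp; have := in_set0 p; rewrite -U0 inE pU defp.
  by apply/forall_inP => v; rewrite (degree_matching _ _ UM) !inE -leqNgt.
move=> /subset_leq_card; rewrite cardsCs setCK => le.
have := lost_ge UM; rewrite /lost cardsT; move: le; rewrite card_ord /=.
by move: #|deficient U| #|(kcore _ _ _).1|; lia.
Qed.

(** * Effect of removing one pair *)

Section Step.

Variables (U : {set point}) (p q : point).
Hypotheses (pP : p \in pending U) (qU : q \in U :\ p).
Local Notation U' := (U :\: [set p; q]).

Let pU : p \in U. Proof. by move: pP; rewrite inE => /andP[]. Qed.
Let pD : tag p \in deficient U. Proof. by move: pP; rewrite inE => /andP[]. Qed.

(** A newly deficient vertex brings at most [k.-1] pending points, and [p] disappears. This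
    preserves the invariant [t + #|pending U| <= k.-1 * #|deficient U|]: long survival forces many
    deficient vertices. *)
Lemma pending_step_le :
  #|pending U'|.+1 + k.-1 * #|deficient U| <=
  #|pending U| + k.-1 * #|deficient U'|.
Proof.
have DS : deficient U \subset deficient U' by apply: deficientS (subsetDl _ _).
have -> : #|deficient U'| = #|deficient U| + #|deficient U' :\: deficient U|.
  by rewrite -(cardsID (deficient U) (deficient U')) (setIidPr DS).
rewrite !card_pending (big_setID (deficient U)) /= (setIidPr DS).
have lt1 : \sum_(v in deficient U) #|U' :&: bin v| <
           \sum_(v in deficient U) #|U :&: bin v|.
  rewrite (bigD1 (tag p)) //= [ltnRHS](bigD1 (tag p)) //= -addSn.
  apply: leq_add; last first.
    by apply: leq_sum => v _; apply: subset_leq_card; apply: setSI; apply: subsetDl.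
  apply: proper_card; apply/properP; split; first by apply/setSI/subsetDl.
  by exists p; rewrite !inE ?eqxx ?pU.
have le2 : \sum_(v in deficient U' :\: deficient U) #|U' :&: bin v| <=
           k.-1 * #|deficient U' :\: deficient U|.
  rewrite mulnC -sum_nat_const; apply: leq_sum => v; rewrite inE => /andP[_].
  by rewrite inE; case: k.
by rewrite mulnDr [leqRHS]addnCA [leqLHS]addnC leq_add2l -addSn leq_add.
Qed.

(** Deficient vertices stay deficient, so a pending point is lost only by being removed. *)
Lemma pending_step_ge : #|pending U| <= #|pending U'| + #|pending U :&: [set p; q]|.
Proof.
rewrite -(cardsID [set p; q] (pending U)) addnC leq_add2r; apply: subset_leq_card.
apply/subsetP => r /setDP[/setIdP[rU rD] rpq]; apply/setIdP; split.
  by rewrite in_setD rpq.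
by apply: (subsetP (deficientS _)) rD; apply: subsetDl.
Qed.

Lemma pending_step_ge2 : #|pending U| <= #|pending U'|.+2.
Proof.
apply: leq_trans pending_step_ge _; rewrite -addn2 leq_add2l.
apply: leq_trans (subset_leq_card (subsetIr _ _)) _.
by rewrite cards2; case: eqP.
Qed.

Lemma pending_step_ge1 : q \notin pending U -> #|pending U| <= #|pending U'|.+1.
Proof.
move=> qP; apply: leq_trans pending_step_ge _; rewrite -addn1 leq_add2l.
rewrite -(cards1 p); apply: subset_leq_card; apply/subsetP => r.
case/setIP => rP /set2P[->|rq]; first exact: set11.
by rewrite -rq rP in qP.
Qed.

Lemma pending_step_tight : #|U :&: bin (tag q)| = k ->
  #|pending U| + k.-1 <= #|pending U'|.+1.
Proof.
move=> tight; have /setD1P[qp qU0] := qU.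
have qD : tag q \notin deficient U by rewrite inE tight ltnn.
have dis r : r \in pending U -> tag r != tag q.
  by rewrite inE => /andP[_]; apply: contraTneq => ->.
have sub : (pending U :\ p) :|: ((U :&: bin (tag q)) :\ q) \subset pending U'.
  apply/subsetP => r /setUP[/setD1P[rp rP]|/setD1P[rq /setIP[rU]]].
    have rq : r != q by apply: contraNneq (dis r rP) => ->.
    have /setIdP[rU rD] := rP; apply/setIdP; split.
      by rewrite !inE negb_or rp rq.
    by apply: (subsetP (deficientS _)) rD; apply: subsetDl.
  rewrite mem_bin => /eqP tr; apply/setIdP; split.
    by rewrite !inE negb_or rq rU !andbT; apply: contraNneq (dis p pP) => <-; apply/eqP.
  rewrite tr inE -[ltnRHS]tight; apply: proper_card; apply/properP; split.
    by apply/setSI/subsetDl.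
  by exists q; rewrite !inE ?eqxx ?orbT ?qU0.
have I0 : (pending U :\ p) :&: ((U :&: bin (tag q)) :\ q) = set0.
  apply/eqP; rewrite -subset0; apply/subsetP => r.
  case/setIP=> /setD1P[_ /dis trq] /setD1P[_ /setIP[_]].
  by rewrite mem_bin (negPf trq).
have := subset_leq_card sub; rewrite cardsU I0 cards0 subn0.
have := cardsD1 p (pending U); rewrite pP => ->.
have := cardsD1 q (U :&: bin (tag q)); rewrite tight in_setI qU0 mem_bin eqxx => -> /=.
by rewrite add1n !addSn ltnS.
Qed.

End Step.

Lemma card_deficient U : (forall i, k <= d i) -> #|deficient U| <= #|~: U|.
Proof.
move=> kd; apply: leq_trans (leq_imset_card (fun p : point => tag p) _).
apply: subset_leq_card; apply/subsetP => v; rewrite inE => ltk.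
have : ~~ (bin v \subset U).
  apply/negP => /setIidPr e; move: ltk; rewrite e card_bin.
  by rewrite ltnNge kd.
case/subsetPn => p; rewrite mem_bin => /eqP <- pU.
by apply/imsetP; exists p; rewrite ?inE.
Qed.

Definition tight U : {set point} := [set p in U | #|U :&: bin (tag p)| == k].

(** A degree-[k] vertex with intact bin gives [k] tight points, and each removed point spoils at
    most one such vertex. *)
Lemma card_tight U : k * num_deg k d <= #|tight U| + k * #|~: U|.
Proof.
rewrite (card_tag U (fun v => #|U :&: bin v| == k)).
rewrite (eq_bigr (fun=> k)); last by move=> v /eqP.
rewrite sum_nat_const [X in _ <= X + _]mulnC -mulnDr leq_mul2l; apply/orP; right.
apply: leq_trans (leq_add (leqnn _) (leq_imset_card (fun p : point => tag p) _)).
rewrite -[X in _ <= X + _]cardsE -cardsUI; apply: leq_trans (leq_addr _ _).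
apply: subset_leq_card; apply/subsetP => v; rewrite !inE => /eqP dv.
have [binU|/subsetPn[p]] := boolP (bin v \subset U).
  apply/orP; left; change (#|U :&: bin v| == k).
  by rewrite (setIidPr binU) card_bin dv eqxx.
rewrite mem_bin => /eqP <- pU; apply/orP; right; apply/imsetP.
by exists p; rewrite ?inE.
Qed.

End Stripping.

(** * Supermartingale bound on extinction *)

Section Survival.

Variables (n : nat) (d : 'I_n -> nat) (k : nat).
Variables (R : realFieldType) (theta rho : R).
Hypothesis kd : forall i, k <= d i.
Hypotheses (theta_gt0 : (0 < theta)%R) (theta_le1 : (theta <= 1)%R).
Hypotheses (rho_gt0 : (0 < rho)%R) (rho_le1 : (rho <= 1)%R).
Local Notation point := (point d).
Local Notation bin := (bin d).
Local Notation pending := (pending k).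
Local Notation deficient := (deficient k).
Local Notation tight := (tight k).
Implicit Types (U Z : {set point}) (M : {set {set point}}).

Local Open Scope ring_scope.

Let theta_ge0 : 0 <= theta := ltW theta_gt0.

(** From [L] pending points the next number plus one is at least [L + k - 1] if [q] is tight,
    [L - 1] if [q] is pending, and [L] otherwise. The factor [theta] on the left supplies this plus
    one and avoids negative powers. *)
Lemma pending_drift U p : p \in pending U ->
  \sum_(q in U :\ p) theta ^+ #|pending (U :\: [set p; q])| * theta <=
  theta ^+ #|pending U| *
    ((#|U|.-1)%:R - #|tight U|%:R * (1 - theta ^+ k.-1)
       + (#|pending U|.-1)%:R / theta).
Proof.
move=> pP; have /setIdP[pU pD] := pP.
have pT : p \notin tight U by rewrite inE pU; move: pD; rewrite inE ltn_neqAle => /andP[].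
have [L defL] : exists L, #|pending U| = L.+1.
  by exists #|pending U|.-1; rewrite prednK // card_gt0; apply/set0Pn; exists p.
pose w q : R := 1 - (q \in tight U)%:R * (1 - theta ^+ k.-1)
  + (q \in pending U)%:R / theta.
apply: (@le_trans _ _ (\sum_(q in U :\ p) theta ^+ L.+1 * w q)); last first.
  rewrite -mulr_sumr defL ler_wpM2l ?exprn_ge0 // !big_split /= sumr_const sumrN.
  have cU : #|U :\ p| = #|U|.-1 by rewrite (cardsD1 p U) pU.
  have ind (A : {set point}) : A \subset U ->
      \sum_(q in U :\ p) (q \in A)%:R = #|A :\ p|%:R :> R.
    move=> AU; rewrite -natr_sum -sum1_card; congr _%:R.
    rewrite [RHS](eq_bigl (fun q => (q \in U :\ p) && (q \in A))); last first.
      move=> q; rewrite !inE; have [/(subsetP AU)->|] := boolP (q \in A).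
        by rewrite !andbT.
      by rewrite !andbF.
    by rewrite big_mkcondr.
  rewrite -!mulr_suml !ind; first last.
  - by apply/subsetP => q; rewrite inE => /andP[].
  - by apply/subsetP => q; rewrite inE => /andP[].
  have -> : tight U :\ p = tight U by apply/setDidPl; rewrite disjoint_sym disjoints1.
  have -> : #|pending U :\ p| = L by move: defL; rewrite (cardsD1 p) pP => -[].
  by rewrite cU.
apply: ler_sum => q qU; rewrite -exprSr.
have [qT|qT] := boolP (q \in tight U).
  have /setIdP[qU0 /eqP tq] := qT.
  have qP : q \notin pending U by rewrite inE qU0 inE tq ltnn.
  rewrite /w qT (negPf qP) mul0r addr0 mul1r subKr -exprD.
  by apply: ler_wiXn2l => //; have := pending_step_tight pP qU tq; rewrite defL.
rewrite /w (negPf qT) mul0r subr0.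
have [qP|qP] := boolP (q \in pending U).
  rewrite mulrDr mulr1 mul1r [X in _ + X / _]exprSr mulfK ?lt0r_neq0 //.
  rewrite -[leLHS]add0r lerD ?exprn_ge0 //; apply: ler_wiXn2l => //.
  by have := @pending_step_ge2 _ d k U p q; rewrite defL.
rewrite mul0r addr0 mulr1; apply: ler_wiXn2l => //.
by have := @pending_step_ge1 _ d k U p q qP; rewrite defL.
Qed.

(* [theta ^+ #|pending U| * rho ^- t] is a supermartingale before time [tau].  The
   subtraction in the exponent [T.-1 - t] is truncated: the exponent is 0 as soon
   as extinction at time [t], which loses at most [2 t + 2] vertices, can fulfil
   [Q]. *)
Lemma lost_gap (m T tau : nat) (Q : pred nat) :
  #|point| = m.*2 ->
  (forall w, Q w -> T.*2 <= w /\ w * k.-1 < tau)%N ->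
  (forall U p, (#|~: U| < tau.+1.*2)%N -> p \in pending U ->
     (#|U|.-1)%:R - #|tight U|%:R * (1 - theta ^+ k.-1)
       + (#|pending U|.-1)%:R / theta <= rho * theta * (#|U|.-1)%:R) ->
  forall j t U, #|U| = j.*2 -> (t + j).+1 = m ->
  (t + #|pending U| <= k.-1 * #|deficient U|)%N ->
  \sum_(M in matchings U) (Q (lost k M))%:R <=
    #|matchings U|%:R * (theta ^+ #|pending U| * rho ^+ (T.-1 - t)).
Proof.
move=> cP QT drift j t U; have [N] := ubnP j.
elim: N j t U => // N IH j t U /ltnSE leN cU tj inv.
(* Two points belong to the deleted edge and two to each of the [t] revealed pairs. *)
have cC : #|~: U| = t.+1.*2 by have := cardsC U; rewrite cU cP -tj; lia.
have bound_ge0 i l : 0 <= theta ^+ i * rho ^+ l :> R.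
  by rewrite mulr_ge0 ?exprn_ge0 // ltW.
have [P0|/set0Pn[p pP]] := eqVneq (pending U) set0.
  rewrite mulr_natl -sumr_const; apply: ler_sum => M UM.
  rewrite (lost_stop UM P0) P0 cards0 mul1r.
  have [/QT[T_le _]|_] := boolP (Q _); last by rewrite exprn_ge0 // ltW.
  suff -> : (T.-1 - t = 0)%N by [].
  by have := card_deficient U kd; rewrite cC; lia.
(* From time [tau] on, the invariant gives [tau <= lost k M * k.-1], which [Q] excludes: no matching
   counts. *)
have [le_tau|lt_tau] := leqP tau t.
  rewrite big1 => [|M UM]; first exact: mulr_ge0.
  case: (boolP (Q _)) => // /QT[_].
  rewrite ltnNge => /negP[]; apply: leq_trans le_tau _.
  rewrite mulnC; apply: leq_trans (leq_trans (leq_addr _ _) inv) _.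
  by rewrite leq_mul2l lost_ge // orbT.
have pU : p \in U by move: pP; rewrite inE => /andP[].
case: j => [|j] in leN cU tj *.
  by move: pU; move/eqP: cU; rewrite cards_eq0 => /eqP ->; rewrite inE.
rewrite (sum_matchings_point _ pU).
have cM q : q \in U :\ p -> #|U :\: [set p; q]| = j.*2.
  by move=> qU; move: cU; rewrite (card_pair_del pU qU); lia.
have step q : q \in U :\ p ->
    \sum_(M in matchings (U :\: [set p; q])) (Q (lost k ([set p; q] |: M)))%:R <=
    (\prod_(i < j) i.*2.+1)%N%:R *
      (theta ^+ #|pending (U :\: [set p; q])| * rho ^+ (T.-1 - t.+1)).
  move=> qU; rewrite -(card_matchings (cM q qU)).
  apply: le_trans (IH j t.+1 (U :\: [set p; q]) _ (cM q qU) _ _); last 3 first.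
  - exact: leN.
  - by rewrite -tj; lia.
  - have := @pending_step_le _ d k U p q pP; move: inv.
    move: #|pending U| #|pending _| (k.-1 * #|deficient U|)%N (k.-1 * #|deficient _|)%N.
    by lia.
  have e2 : #|[set p; q]| = 2%N.
    by move: qU => /setD1P[qp _]; rewrite cards2 eq_sym qp.
  (* The two sums agree: the restored pair contains the pending point [p], so it does not change
     [lost]. *)
  rewrite le_eqVlt; apply/orP; left; apply/eqP/eq_bigr => M UM.
  have UpM : [set p; q] |: M \in matchings U.
    apply: matchings_add => //; apply/subsetP => r /set2P[->//|->].
    by have /setD1P[] := qU.
  rewrite -[in RHS](setU1K (matchings_notin e2 UM)).
  by rewrite (lost_pending UpM (setU11 _ _) (set21 p q)).
apply: le_trans (ler_sum _ step) _; rewrite -mulr_sumr -mulr_suml.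
have cU1 : #|U|.-1 = j.*2.+1 by rewrite cU doubleS.
have sum_le : \sum_(q in U :\ p) theta ^+ #|pending (U :\: [set p; q])| <=
    theta ^+ #|pending U| * rho * j.*2.+1%:R.
  rewrite -(ler_pM2r theta_gt0) mulr_suml; apply: le_trans (pending_drift pP) _.
  rewrite -!mulrA ler_wpM2l ?exprn_ge0 // -cU1.
  apply: le_trans (drift U p _ pP) _; first by rewrite cC ltn_double.
  by rewrite -mulrA [theta * _]mulrC.
rewrite (card_matchings cU) big_ord_recr /= natrM -!mulrA ler_wpM2l //.
rewrite mulrA; apply: le_trans (ler_wpM2r _ sum_le) _; first by rewrite exprn_ge0 // ltW.
have -> : theta ^+ #|pending U| * rho * j.*2.+1%:R * rho ^+ (T.-1 - t.+1) =
   j.*2.+1%:R * (theta ^+ #|pending U| * rho ^+ (T.-1 - t.+1).+1).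
  by rewrite exprS; ring.
(* Even with truncation, [T.-1 - t <= (T.-1 - t.+1).+1]. *)
rewrite -[leRHS]mulrA !ler_wpM2l ?exprn_ge0 //; apply: ler_wiXn2l => //; first exact: ltW.
by lia.
Qed.

Lemma sum_lost_gap (m T tau : nat) (Q : pred nat) :
  #|point| = m.*2 ->
  (forall w, Q w -> T.*2 <= w /\ w * k.-1 < tau)%N ->
  (forall U p, (#|~: U| < tau.+1.*2)%N -> p \in pending U ->
     (#|U|.-1)%:R - #|tight U|%:R * (1 - theta ^+ k.-1)
       + (#|pending U|.-1)%:R / theta <= rho * theta * (#|U|.-1)%:R) ->
  \sum_(M in perfect_matchings d) \sum_(e in M) (Q (lost k (M :\ e)))%:R <=
  \sum_(M in perfect_matchings d) \sum_(e in M)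
     theta ^+ #|pending (~: e)| * rho ^+ T.-1.
Proof.
move=> cP QT drift.
rewrite (@sum_matchings_edges _ _ [set: point] (fun _ M => (Q (lost k M))%:R)).
rewrite (@sum_matchings_edges _ _ [set: point]
  (fun e _ => theta ^+ #|pending (~: e)| * rho ^+ T.-1)).
apply: ler_sum => e /andP[_ /eqP e2]; rewrite sumr_const -mulr_natl setTD.
rewrite -[X in rho ^+ X]subn0.
have m_gt0 : (0 < m)%N.
  by rewrite -double_gt0 -cP; apply: leq_trans (max_card (mem e)); rewrite e2.
apply: (lost_gap (j := m.-1) cP QT drift).
- by have := cardsC e; rewrite cP e2; case: m {cP QT drift} m_gt0 => // m _ [].
- by rewrite add0n prednK.
- by rewrite add0n pending_le.
Qed.

(** A deleted edge meeting a vertex of degree [k] leaves a pending point, so its term is at most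
    [theta]. Such edges number at least half the points in those vertices. *)
Lemma sum_pending_matching M : (2 < k)%N -> M \in perfect_matchings d ->
  \sum_(e in M) theta ^+ #|pending (~: e)| <=
  #|M|%:R - (1 - theta) * (k * num_deg k d)%:R / 2.
Proof.
move=> k3 /matchingsP[pM M2].
pose Z := [set p : point | d (tag p) == k].
have cZ : #|Z| = (k * num_deg k d)%N.
  have -> : Z = [set p in [set: point] | d (tag p) == k].
    by apply/setP => p; rewrite !inE.
  rewrite (card_tag [set: point] (fun v => d v == k)).
  rewrite (eq_bigr (fun=> k)) => [|v /eqP dv]; last by rewrite setTI card_bin.
  by rewrite sum_nat_const mulnC /num_deg cardsE.
have -> : (k * num_deg k d = \sum_(e in M) #|e :&: Z|)%N.
  rewrite -cZ -sum1_card.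
  rewrite (eq_bigl (fun p => (p \in [set: point]) && (p \in Z))) => [|p]; last first.
    by rewrite in_setT.
  rewrite (set_partition_big_cond _ pM); apply: eq_bigr => e _.
  by rewrite -sum1_card; apply: eq_bigl => p; rewrite in_setI.
rewrite natr_sum mulr_sumr mulr_suml -sumr_const -sumrB.
apply: ler_sum => e eM; have e2 := M2 e eM.
have [->|/set0Pn[p /setIP[pe pZ]]] := eqVneq (e :&: Z) set0.
  by rewrite cards0 mulr0 mul0r subr0 exprn_ile1.
have le2 : (#|e :&: Z| <= 2)%N by rewrite -e2 subset_leq_card // subsetIl.
apply: (@le_trans _ _ theta); last first.
  have : (#|e :&: Z|%:R : R) <= 2 by rewrite (ler_nat R _ 2).
  move: (#|e :&: Z|%:R : R) => z; have := theta_le1; nra.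
rewrite -[leRHS]expr1; apply: ler_wiXn2l => //; rewrite card_gt0.
have cbin : #|bin (tag p)| = k by rewrite card_bin; apply/eqP; move: pZ; rewrite inE.
(* As [k] exceeds 2, the bin has a point outside [e], and that point is pending. *)
have /subsetPn[r rbin re] : ~~ (bin (tag p) \subset e).
  by apply/negP => /subset_leq_card; rewrite cbin e2 leqNgt k3.
apply/set0Pn; exists r; rewrite inE in_setC re; move: rbin; rewrite mem_bin => /eqP ->.
rewrite inE -[ltnRHS]cbin; apply: proper_card; apply/properP; split.
  exact: subsetIr.
by exists p; rewrite ?mem_bin // !inE negb_and pe.
Qed.

End Survival.

(** * Probabilities of extinction *)

Section Constants.

Variable R : realFieldType.
Local Open Scope ring_scope.

(** The coefficient [r%:R ^+ 2], cruder than the binomial one, makes the induction step an explicit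
    sum of nonnegative terms. *)
Lemma one_minus_exp_le (x : R) r : 0 <= x <= 1 ->
  (1 - x) ^+ r <= 1 - r%:R * x + r%:R ^+ 2 * x ^+ 2.
Proof.
case/andP=> x0 x1; elim: r => [|r IH].
  by rewrite expr0 mul0r subr0 expr0n mul0r addr0.
rewrite exprSr; apply: le_trans (ler_wpM2r _ IH) _; first by rewrite subr_ge0.
have r0 : 0 <= r%:R :> R by [].
rewrite -natr1; move: (r%:R) r0 => a a0; rewrite -subr_ge0.
have -> : 1 - (a + 1) * x + (a + 1) ^+ 2 * x ^+ 2 -
   (1 - a * x + a ^+ 2 * x ^+ 2) * (1 - x) = (a + 1) * x ^+ 2 + a ^+ 2 * x ^+ 3.
  by ring.
by rewrite addr_ge0 // mulr_ge0 ?exprn_ge0 // addr_ge0.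
Qed.

(** For [r = k.-1], [(1 + delta) / r%:R] bounds the proportion of tight points from below and
    [alpha] that of pending points from above; [pending_drift] then contracts by [rho]. *)
Lemma drift_constants r (delta : R) : (0 < r)%N -> 0 < delta <= 1 ->
  exists theta rho alpha : R,
    [/\ 0 < theta < 1, 0 < rho < 1, 0 < alpha &
     1 - (1 + delta) / r%:R * (1 - theta ^+ r) + alpha / theta <= rho * theta].
Proof.
move=> r_gt0 /andP[d0 d1].
have r1 : 1 <= r%:R :> R by rewrite ler1n.
have r0 : 0 < r%:R :> R by rewrite ltr0n.
(* For this [x], [(1 + delta) * (x - r%:R * x ^+ 2) = x * (1 + delta / 2)] exceeds
   the loss [x = 1 - theta]. *)
pose x := delta / (2 * r%:R * (1 + delta)).
have xE : r%:R * x * (1 + delta) = delta / 2.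
  rewrite /x; move: (r%:R) r1 => a a1; field.
  by apply/andP; split; lra.
have x0 : 0 < x by rewrite divr_gt0 // !mulr_gt0 //; lra.
have x_le : x <= 2^-1.
  rewrite /x ler_pdivrMr ?mulr_gt0 //; last by lra.
  by move: (r%:R) r1 => a a1; nra.
have bern := @one_minus_exp_le x r.
have {}bern : (1 - x) ^+ r <= 1 - r%:R * x + r%:R ^+ 2 * x ^+ 2.
  by apply: bern; rewrite ltW //=; lra.
have gain : x * (1 + delta / 2) <= (1 + delta) / r%:R * (1 - (1 - x) ^+ r).
  have -> : x * (1 + delta / 2) =
      (1 + delta) / r%:R * (r%:R * x - r%:R ^+ 2 * x ^+ 2).
    have -> : (1 + delta) / r%:R * (r%:R * x - r%:R ^+ 2 * x ^+ 2) =
       (1 + delta) * x - x * (r%:R * x * (1 + delta)).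
      by field; rewrite lt0r_neq0.
    by rewrite xE; field.
  by apply: ler_wpM2l; [rewrite divr_ge0 //; lra | lra].
(* Of the excess [x * delta / 2], one half pays for [alpha / theta] and the other for [rho]. *)
exists (1 - x), (1 - x * delta / 4), ((1 - x) * (x * delta / 4)).
have s0 : 0 < x * delta / 4 by rewrite divr_gt0 // mulr_gt0.
have s1 : x * delta / 4 <= 8^-1 by nra.
split; [by apply/andP; split; lra | by apply/andP; split; lra | by rewrite mulr_gt0 //; lra |].
rewrite [(1 - x) * _]mulrC mulfK; last by rewrite lt0r_neq0 //; lra.
by move: s0 gain; rewrite -mulrA; nra.
Qed.

End Constants.

(** * [prob_W] as a sum over matchings and edges *)

Section ProbW.

Variables (R : realType) (n : nat) (d : 'I_n -> nat) (k : nat).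
Local Notation point := (point d).
Local Open Scope ring_scope.

Lemma card_point : #|point| = (\sum_i d i)%N.
Proof.
transitivity #|[set p in [set: point] | predT (tag p)]|.
  by apply: eq_card => p; rewrite !inE.
by rewrite card_tag; apply: eq_bigr => v _; rewrite setTI card_bin.
Qed.

Variables (m : nat).
Hypotheses (sum_d : (\sum_i d i = 2 * m)%N) (m_gt0 : (0 < m)%N).

Let card_point2 : #|point| = m.*2. Proof. by rewrite card_point sum_d mul2n. Qed.

Lemma perfect_matchings_gt0 : (0 < #|perfect_matchings d|)%N.
Proof.
have cT : #|[set: point]| = m.*2 by rewrite cardsT.
by rewrite [perfect_matchings d](_ : _ = matchings [set: point]) // (card_matchings cT) prodn_gt0.
Qed.

Lemma card_perfect_matching M : M \in perfect_matchings d -> #|M| = m.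
Proof.
by move=> /(@card_matching _ [set: point]); rewrite cardsT card_point2 => /double_inj.
Qed.

Lemma prob_WE (Q : pred nat) : prob_W R k d Q =
  (\sum_(M in perfect_matchings d) \sum_(e in M) (Q (lost k (M :\ e)))%:R)
    / (m * #|perfect_matchings d|)%:R.
Proof.
rewrite /prob_W /unif_mean natrM invfM mulrA; congr (_ / _).
by rewrite mulr_suml; apply: eq_bigr => M /card_perfect_matching /= ->.
Qed.

Lemma prob_W_le (Q : pred nat) (b : R) :
  \sum_(M in perfect_matchings d) \sum_(e in M) (Q (lost k (M :\ e)))%:R <=
    \sum_(M in perfect_matchings d) m%:R * b ->
  prob_W R k d Q <= b.
Proof.
move=> le; have PM := perfect_matchings_gt0.
rewrite prob_WE ler_pdivrMr ?ltr0n ?muln_gt0 ?m_gt0 //; apply: le_trans le _.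
by rewrite sumr_const natrM mulrA [b * _]mulrC mulr_natr.
Qed.

Lemma prob_WC (Q : pred nat) : prob_W R k d Q = 1 - prob_W R k d (predC Q).
Proof.
apply/eqP; rewrite eq_sym subr_eq eq_sym; apply/eqP.
have PM := perfect_matchings_gt0.
rewrite !prob_WE -mulrDl -big_split /=.
rewrite (eq_bigr (fun=> m%:R)); last first.
  move=> M /card_perfect_matching cM; rewrite -big_split /= -{1}cM -sumr_const.
  by apply: eq_bigr => e _; case: (Q _); rewrite ?addr0 ?add0r.
by rewrite sumr_const -[_ *+ #|_|]mulr_natr -natrM divff // pnatr_eq0 -lt0n muln_gt0 m_gt0.
Qed.

Lemma prob_W_ge0 (Q : pred nat) : 0 <= prob_W R k d Q.
Proof. by rewrite prob_WE divr_ge0 // sumr_ge0 // => M _; rewrite sumr_ge0. Qed.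

Lemma prob_W_homo (Q Q' : pred nat) : (forall w, Q w -> Q' w) ->
  prob_W R k d Q <= prob_W R k d Q'.
Proof.
move=> QQ'; rewrite !prob_WE ler_wpM2r ?invr_ge0 //.
apply: ler_sum => M _; apply: ler_sum => e _; rewrite ler_nat.
by case: (boolP (Q _)) => // /QQ' ->.
Qed.

Hypothesis kd : forall i, (k <= d i)%N.

(** One [delta] pays for the tight points spoiled by the [u] removed points, the other remains as
    drift. At most [k.-1 * u] points are pending, and [u < m] puts [#|U|.-1] between [m] and
    [2 * m]. *)
Lemma drift_condition (delta theta rho alpha : R) (u : nat) (U : {set point}) :
  (1 < k)%N -> 0 < delta -> 0 < theta <= 1 -> 0 < alpha -> 
  1 - (1 + delta) / k.-1%:R * (1 - theta ^+ k.-1) + alpha / theta <= rho * theta ->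
  (1 + delta + delta) * (2 * m)%:R <= (k.-1 * (k * num_deg k d))%:R ->
  #|~: U| = u -> (u < m)%N ->
  (k.-1 * (k * u))%:R <= delta * (2 * m)%:R -> (k.-1 * u)%:R <= alpha * m%:R ->
  (#|U|.-1)%:R - #|tight k U|%:R * (1 - theta ^+ k.-1)
     + (#|pending k U|.-1)%:R / theta <= rho * theta * (#|U|.-1)%:R.
Proof.
move=> k1 d0 /andP[t0 t1] a0 const degk cU um uk ua.
have cU2 : (u + #|U| = 2 * m)%N by rewrite -cU addnC cardsC card_point sum_d.
set N := #|U|.-1; have N_ge : (m <= N)%N by rewrite /N; lia.
have N_le : (N <= 2 * m)%N by rewrite /N; lia.
have r0 : 0 < k.-1%:R :> R by rewrite ltr0n; lia.
have tight_ge : (1 + delta) / k.-1%:R * N%:R <= #|tight k U|%:R.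
  rewrite mulrAC ler_pdivrMr //; have := card_tight k U; rewrite cU => tU.
  have : (k.-1 * (k * num_deg k d) <= k.-1 * #|tight k U| + k.-1 * (k * u))%N.
    by rewrite -mulnDr leq_mul2l tU orbT.
  rewrite -(ler_nat R) natrD => {}tU.
  apply: (@le_trans _ _ ((1 + delta) * (2 * m)%:R)).
    by rewrite ler_wpM2l ?ler_nat // addr_ge0 // ltW.
  rewrite [leRHS]mulrC -natrM; lra.
have pend_le : #|pending k U|.-1%:R <= alpha * N%:R.
  apply: (@le_trans _ _ (k.-1 * u)%:R).
    rewrite ler_nat; apply: leq_trans (leq_pred _) _.
    apply: leq_trans (pending_le k U) _.
    by rewrite leq_mul2l -cU card_deficient // orbT.
  by apply: le_trans ua _; rewrite ler_wpM2l ?ler_nat // ltW.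
have e1 : 0 <= 1 - theta ^+ k.-1 by rewrite subr_ge0 exprn_ile1 // ltW.
have /(ler_wpM2r e1) := tight_ge.
have tV0 : 0 <= theta^-1 by rewrite invr_ge0 ltW.
have /(ler_wpM2r tV0) := pend_le.
have /(ler_wpM2r (ler0n R N)) := const.
rewrite mulrDl mulrBl mul1r [_ * (1 - _) * _]mulrAC [alpha / _ * _]mulrAC.
move: (_ * N%:R / theta) (_ * N%:R * (1 - _)) => A B; lra.
Qed.

End ProbW.

Section Bounds.

Local Open Scope ring_scope.

Lemma prob_W_bounds (R : realType) (k : nat) (delta : R) :
  (2 < k)%N -> 0 < delta <= 1 ->
  exists eps' theta rho : R, exists N0 : nat,
    [/\ 0 < eps', 0 < theta < 1, 0 < rho < 1 &
     forall n m (d : 'I_n -> nat), (N0 <= n <= m)%N -> degree_seq k m d ->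
       (1 + delta + delta) * (2 * m)%:R <= (k.-1 * (k * num_deg k d))%:R ->
       (forall T, prob_W R k d
          (fun w => (T.*2 <= w)%N && (w%:R < eps' * n%:R)) <= rho ^+ T.-1) /\
       prob_W R k d (fun w => w%:R < eps' * n%:R) <= 1 - (1 - theta) / k.-1%:R].
Proof.
move=> k3 /[dup] d01 /andP[d0 d1].
have r_gt0 : (0 < k.-1)%N by case: k k3 => [|[]].
have [theta [rho [alpha [t01 rho01 a0 const]]]] := drift_constants r_gt0 d01.
have /andP[t0 t1] := t01; have /andP[p0 p1] := rho01.
have r0 : 0 < k.-1%:R :> R by rewrite ltr0n.
have k0 : 0 < k%:R :> R by rewrite ltr0n; apply: ltn_trans k3.
(* For [u <= beta * m], the three terms give the three bounds on [u] in [drift_condition]. *)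
pose beta := Num.min 2^-1 (Num.min (2 * delta / (k.-1%:R * k%:R)) (alpha / k.-1%:R)).
have b0 : 0 < beta by rewrite !lt_min invr_gt0 ltr0n /= !divr_gt0 ?mulr_gt0.
have [b1 b2 b3] : [/\ beta <= 2^-1, k.-1%:R * k%:R * beta <= 2 * delta &
    k.-1%:R * beta <= alpha].
  split; first by rewrite /beta ge_min lexx.
    by rewrite mulrC -ler_pdivlMr ?mulr_gt0 // /beta !ge_min lexx orbT.
  by rewrite mulrC -ler_pdivlMr // /beta !ge_min lexx !orbT.
(* Drift is needed up to about [beta * n / 4] steps, when at most [beta * n / 2 + 3] points are
   removed; [6 <= beta * n] makes this at most [beta * n]. *)
pose eps' := beta / (4 * k.-1%:R).
have e0 : 0 < eps' by rewrite divr_gt0 ?mulr_gt0.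
exists eps', theta, rho, (Num.truncn (6 / beta)).+1; split=> // n m d.
case/andP=> n_ge nm [sum_d kd] degk.
have n_large : 6 <= beta * n%:R.
  rewrite mulrC -ler_pdivrMr //; apply: le_trans (ltW (truncnS_gt _)) _.
  by rewrite ler_nat.
have m_gt0 : (0 < m)%N by apply: leq_trans nm; apply: leq_trans n_ge.
have nmR : n%:R <= m%:R :> R by rewrite ler_nat.
pose t := Num.truncn (eps' * n%:R * k.-1%:R); pose tau := t.+1.
have tau_gt : eps' * n%:R * k.-1%:R < tau%:R by exact: truncnS_gt.
have tau_le : (tau.*2.+1)%:R <= beta * m%:R.
  have : t%:R <= eps' * n%:R * k.-1%:R.
    by rewrite truncn_le; apply: mulr_ge0 => //; apply: mulr_ge0 => //; exact: ltW.
  have -> : eps' * n%:R * k.-1%:R = beta * n%:R / 4.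
    by rewrite /eps'; field; rewrite lt0r_neq0.
  have -> : tau.*2.+1 = (2 * t + 3)%N by rewrite /tau mul2n doubleS -addn3.
  rewrite natrD natrM => le4.
  apply: (@le_trans _ _ (beta * n%:R)); last by rewrite ler_pM2l.
  by move: (t%:R) (beta * _) le4 n_large => x y; lra.
have gap (T : nat) (Q : pred nat) :
    (forall w, Q w -> (T.*2 <= w)%N /\ w%:R < eps' * n%:R) ->
    \sum_(M in perfect_matchings d) \sum_(e in M) (Q (lost k (M :\ e)))%:R <=
    \sum_(M in perfect_matchings d) \sum_(e in M)
       theta ^+ #|pending k (~: e)| * rho ^+ T.-1.
  move=> QT; apply: (@sum_lost_gap _ _ _ _ theta rho kd t0 (ltW t1) p0 (ltW p1) m T tau).
  - by rewrite card_point sum_d mul2n.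
  - move=> w /QT[-> wlt]; split=> //; rewrite -(ltr_nat R) natrM.
    by apply: le_lt_trans tau_gt; rewrite ler_pM2r // ltW.
  move=> U p cU _.
  have {}cU : (#|~: U|)%:R <= beta * m%:R.
    apply: le_trans tau_le; rewrite ler_nat; move: cU.
    by rewrite doubleS ltnS.
  have m0 : 0 < m%:R :> R by rewrite ltr0n.
  apply: (drift_condition sum_d m_gt0 kd (delta := delta) (alpha := alpha)
    (u := #|~: U|)) => //.
  - exact: ltn_trans k3.
  - by rewrite t0 ltW.
  - by rewrite -(ltr_nat R); apply: le_lt_trans cU _; rewrite gtr_pMl //; lra.
  - rewrite !natrM mulrA; apply: le_trans (ler_wpM2l _ cU) _.
      by rewrite mulr_ge0.
    by rewrite !mulrA [delta * _]mulrC ler_pM2r.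
  - by rewrite natrM; apply: le_trans (ler_wpM2l _ cU) _; rewrite // mulrA ler_pM2r.
split=> [T|].
  apply: (prob_W_le sum_d m_gt0); apply: le_trans
    (gap T (fun w => (T.*2 <= w)%N && (w%:R < eps' * n%:R)) _) _.
    by move=> w /andP[].
  apply: ler_sum => M /(card_perfect_matching sum_d) <-.
  rewrite mulr_natl -sumr_const; apply: ler_sum => e _.
  by rewrite ler_piMl ?exprn_ge0 ?exprn_ile1 // ltW.
(* For [T = 0] the power of [rho] is 1, and the gain comes from the initial pending points, with
   [2 * m <= k.-1 * (k * num_deg k d)]. *)
apply: (prob_W_le sum_d m_gt0); apply: le_trans
  (gap 0%N (fun w => w%:R < eps' * n%:R) _) _ => //.
apply: ler_sum => M PM.
under eq_bigr do rewrite mulr1.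
apply: le_trans (sum_pending_matching t0 (ltW t1) k3 PM) _.
rewrite (card_perfect_matching sum_d PM) mulrBr mulr1 lerD2l lerN2 -subr_ge0.
have -> : (1 - theta) * (k * num_deg k d)%:R / 2 - m%:R * ((1 - theta) / k.-1%:R) =
    (1 - theta) / (2 * k.-1%:R) * ((k.-1 * (k * num_deg k d))%:R - (2 * m)%:R).
  by rewrite !(natrM _ k.-1) !(natrM _ 2); field; rewrite lt0r_neq0.
rewrite mulr_ge0 ?divr_ge0 ?mulr_ge0 ?subr_ge0 ?(ltW t1) //.
apply: le_trans degk; rewrite ler_peMl // -addrA lerDl addr_ge0 ?ltW //.
Qed.

End Bounds.

From mathcomp Require Import all_classical all_reals all_analysis.
Import Order.TTheory GRing.Theory Num.Theory.
Import numFieldNormedType.Exports.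
Local Open Scope classical_set_scope.
Local Open Scope ring_scope.

(** * The threshold [ck'] *)

Section TruncatedExponential.

Variable R : realType.
Implicit Types (k : nat) (x y : R).

(** Inequalities about [f_], a tail of the exponential series, are proved on these sums and pass to
    the limit. *)
Definition f_sum k x (N : nat) : R := \sum_(k <= i < N) x ^+ i / i`!%:R.

Lemma f_cvg k x : f_sum k x N @[N --> \oo] --> f_ k x.
Proof.
have cvgE : series (exp_coeff x) N @[N --> \oo] --> expR x.
  exact: is_cvg_series_exp_coeff.
have : (series (exp_coeff x) N - \sum_(i < k) x ^+ i / i`!%:R) @[N --> \oo] --> f_ k x.
  by apply: cvgB => //; exact: cvg_cst.
apply: cvg_trans; apply: near_eq_cvg; near=> N.
have kN : (k <= N)%N by near: N; exact: nbhs_infty_ge.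
rewrite /series /= (big_cat_nat (leq0n k) kN) /= big_mkord.
by rewrite addrAC subrr add0r.
Unshelve. all: by end_near. Qed.

Lemma f_cvgS k x : f_sum k x N.+1 @[N --> \oo] --> f_ k x.
Proof. by rewrite (cvg_shiftS (f_sum k x)); exact: f_cvg. Qed.

Lemma f_ge_term k x : 0 <= x -> x ^+ k / k`!%:R <= f_ k x.
Proof.
move=> x0; apply: (cvgr_to_ge (@f_cvgS k x)); near=> N.
have kN : (k <= N)%N by near: N; exact: nbhs_infty_ge.
rewrite /f_sum big_nat_recl //= lerDl sumr_ge0 // => i _.
by rewrite divr_ge0 ?exprn_ge0.
Unshelve. all: by end_near. Qed.

Lemma f_gt0 k x : 0 < x -> 0 < f_ k x.
Proof.
move=> x0; apply: lt_le_trans (f_ge_term k (ltW x0)).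
by rewrite divr_gt0 ?exprn_gt0 // ltr0n fact_gt0.
Qed.

Lemma f_S k x : f_ k.+1 x = f_ k x - x ^+ k / k`!%:R.
Proof. by rewrite /f_ big_ord_recr /= opprD addrA. Qed.

Lemma f_cvgZ (c : R) k x : c * f_sum k x N @[N --> \oo] --> c * f_ k x.
Proof. by apply: cvgM; [exact: cvg_cst|exact: f_cvg]. Qed.

Lemma swap_powers x y a b : 0 < x -> x <= y -> (a <= b)%N ->
  x ^+ b * y ^+ a <= y ^+ b * x ^+ a.
Proof.
move=> x0 xy ab; have y0 := lt_le_trans x0 xy.
rewrite -(subnK ab) !exprD -!mulrA [y ^+ a * _]mulrC ler_wpM2r //.
  by rewrite mulr_ge0 ?exprn_ge0 // ltW.
by apply: lerXn2r => //; rewrite nnegrE ltW.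
Qed.

(** The quotient of [f_ k x] by [x ^+ k] is a power series with nonnegative coefficients, hence
    nondecreasing. *)
Lemma f_ratio_le k x y : 0 < x -> x <= y -> y ^+ k * f_ k x <= x ^+ k * f_ k y.
Proof.
move=> x0 xy; apply: (ler_cvg_to (@f_cvgZ _ k x) (@f_cvgZ _ k y)).
apply: nearW => N; rewrite /f_sum !mulr_sumr big_nat_cond [leRHS]big_nat_cond.
apply: ler_sum => i /andP[/andP[ki _] _]; rewrite !mulrA ler_wpM2r ?invr_ge0 //.
by rewrite [leLHS]mulrC [leRHS]mulrC swap_powers.
Qed.

(* On partial sums, the monotonicity of the mean [x f_(k-1)(x) / f_k(x)] is a form
   of Chebyshev's sum inequality. *)
Lemma sum_chebyshev (s : seq nat) x y : 0 < x -> x <= y ->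
  (\sum_(i <- s) i%:R * (x ^+ i / i`!%:R)) * (\sum_(i <- s) y ^+ i / i`!%:R) <=
  (\sum_(i <- s) i%:R * (y ^+ i / i`!%:R)) * (\sum_(i <- s) x ^+ i / i`!%:R).
Proof.
move=> x0 xy; rewrite -subr_ge0 !mulr_suml -sumrB.
under eq_bigr do rewrite !mulr_sumr -sumrB.
set D := \sum_(i <- s) _.
(* Exchanging [i] and [j] in one copy of [D] pairs the terms into products of [i - j] and
   [y^i x^j - x^i y^j], which have the same sign. *)
suff : 0 <= D + D by rewrite -mulr2n pmulrn_lge0.
rewrite {2}/D exchange_big /D -big_split sumr_ge0 //= => i _.
rewrite -big_split sumr_ge0 //= => j _.
have -> : i%:R * (y ^+ i / i`!%:R) * (x ^+ j / j`!%:R) -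
    i%:R * (x ^+ i / i`!%:R) * (y ^+ j / j`!%:R) +
    (j%:R * (y ^+ j / j`!%:R) * (x ^+ i / i`!%:R) -
    j%:R * (x ^+ j / j`!%:R) * (y ^+ i / i`!%:R)) =
  (i%:R - j%:R) * (y ^+ i * x ^+ j - x ^+ i * y ^+ j) * (i`!%:R^-1 * j`!%:R^-1).
  by ring.
apply: mulr_ge0; last by rewrite mulr_ge0 ?invr_ge0.
have [ij|/ltnW ij] := leqP i j.
  rewrite -mulrNN mulr_ge0 // opprB subr_ge0 ?ler_nat //.
  by rewrite [leLHS]mulrC [leRHS]mulrC swap_powers.
by rewrite mulr_ge0 // subr_ge0 ?ler_nat // swap_powers.
Qed.

Lemma f_mean_le k x y : 0 < x -> x <= y ->
  x * f_ k x * f_ k.+1 y <= y * f_ k y * f_ k.+1 x.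
Proof.
move=> x0 xy.
(* The index shift puts all sums on the same range, as [sum_chebyshev] requires. *)
have shift z N : z * f_sum k z N = \sum_(k.+1 <= i < N.+1) i%:R * (z ^+ i / i`!%:R).
  rewrite big_add1 /= mulr_sumr; apply: eq_bigr => i _.
  have a0 : i.+1%:R != 0 :> R by rewrite pnatr_eq0.
  have b0 : i`!%:R != 0 :> R by rewrite pnatr_eq0 -lt0n fact_gt0.
  by rewrite factS natrM exprS; move: i.+1%:R i`!%:R a0 b0 => a b a0 b0; field; rewrite b0.
have cvg z w : z * f_sum k z N * f_sum k.+1 w N.+1 @[N --> \oo] --> z * f_ k z * f_ k.+1 w.
  by apply: cvgM; [exact: f_cvgZ|exact: f_cvgS].
apply: (ler_cvg_to (cvg x y) (cvg y x)); apply: nearW => N.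
by rewrite !shift; exact: sum_chebyshev.
Qed.

Lemma is_derive_f k x : is_derive x 1 (f_ k.+1) (f_ k x).
Proof.
elim: k => [|k IH].
  rewrite (_ : f_ 1 = expR - cst 1); last first.
    by apply/funext => y; rewrite /f_ big_ord1 expr0 divr1.
  by apply: is_derive_eq; rewrite /f_ big_ord0.
rewrite (_ : f_ k.+2 = f_ k.+1 - (k.+1)`!%:R^-1 \*: (id ^+ k.+1)); last first.
  by apply/funext => y; rewrite f_S mulrC !fctE; exact: erefl.
apply: is_derive_eq; rewrite f_S; congr (_ - _).
have a0 : k.+1%:R != 0 :> R by rewrite pnatr_eq0.
have b0 : k`!%:R != 0 :> R by rewrite pnatr_eq0 -lt0n fact_gt0.
rewrite /GRing.scale /= mulr1 factS natrM.
by move: k.+1%:R k`!%:R a0 b0 => a b a0 b0; field; rewrite b0.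
Qed.

(** The critical point equation of [h_] is [(1 + mu) f_(k-1) = mu f_(k-2)], where
    [f_(k-2) - f_(k-1) = mu^(k-2) / (k-2)!]. A nonzero [mu_ck R k] is a genuine minimizer, not the
    default value. *)
Lemma mu_ck_root k : (1 < k)%N -> mu_ck R k != 0 ->
  0 < mu_ck R k /\ f_ k.-1 (mu_ck R k) = mu_ck R k ^+ k.-1 / (k.-2)`!%:R.
Proof.
case: k => [//|[//|k]] _; rewrite /mu_ck /=.
case: xgetP => [mu _ [mu0 mu_min] _|_ /eqP//]; split=> //.
(* [g] is [(h_ mu - h_) * f_], so it is maximal at [mu], where it vanishes. *)
pose g : R -> R := h_ k.+2 mu \*: (f_ k.+1 : R -> R) - expR * id.
have dg y : is_derive y 1 g (h_ k.+2 mu * f_ k y - (expR y * y + expR y)).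
  have df := is_derive_f k y.
  apply: is_derive_eq; rewrite /GRing.scale /=; ring.
have g0 y : 0 < y -> g y <= g mu.
  move=> y0.
  have f0 (z : R) : 0 < z -> f_ k.+1 z != 0.
    by move=> z0; exact: lt0r_neq0 (f_gt0 _ z0).
  have gE (z : R) : 0 < z -> g z = (h_ k.+2 mu - h_ k.+2 z) * f_ k.+1 z.
    by move=> z0; rewrite mulrBl [in RHS]/h_ divfK ?f0.
  rewrite !gE // subrr mul0r mulr_le0_ge0 ?subr_le0 ?mu_min //.
  exact/ltW/f_gt0.
have [_ /esym] : is_derive mu 1 g 0.
  apply: (@derive1_at_max _ g 0 (mu + mu)).
  - by rewrite addr_ge0 // ltW.
  - by move=> t _; case: (dg t).
  - by rewrite in_itv /= mu0 ltrDl.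
  - by move=> t; rewrite in_itv /= => /andP[t0 _]; exact: g0.
have [_ ->] := dg mu; rewrite /h_ /=.
have f0 := lt0r_neq0 (f_gt0 k.+1 mu0).
have e0 := lt0r_neq0 (expR_gt0 mu).
have -> : f_ k mu = f_ k.+1 mu + mu ^+ k / k`!%:R by rewrite f_S subrK.
have b0 : k`!%:R != 0 :> R by rewrite pnatr_eq0 -lt0n fact_gt0.
rewrite exprS; move: (f_ k.+1 mu) (expR mu) k`!%:R f0 e0 b0 => f e b f0 e0 b0 E.
(* The last factor is the derivative of [g] at [mu], which is 0 by [E]. *)
have -> : mu * mu ^+ k / b =
    f + f / e * (e * mu / f * (f + mu ^+ k / b) - (e * mu + e)).
  by field; rewrite b0 f0.
by rewrite -E mulr0 addr0.
Qed.

Lemma ck'E k : (1 < k)%N -> mu_ck R k != 0 ->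
  ck' R k = (k * k.-1)%:R * trunc_poisson_pmf k (mu_ck R k) k.
Proof.
move=> k1 muN0; have [mu0 root] := mu_ck_root k1 muN0.
rewrite /ck' /trunc_poisson_pmf (negPf muN0) leqnn root.
move: (mu_ck R k) mu0 => mu mu0.
have f0 := lt0r_neq0 (f_gt0 k mu0).
case: k k1 f0 {muN0 root} => [//|[//|k]] _ f0 /=.
have a0 : k.+1%:R != 0 :> R by rewrite pnatr_eq0.
have a1 : k.+2%:R != 0 :> R by rewrite pnatr_eq0.
have b0 : k`!%:R != 0 :> R by rewrite pnatr_eq0 -lt0n fact_gt0.
rewrite !factS !natrM [mu ^+ k.+2]exprS.
move: k`!%:R k.+1%:R k.+2%:R (mu ^+ k.+1) (f_ k.+2 mu) a0 a1 b0 f0.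
move=> b a a' p f a0 a1 b0 f0; field.
by rewrite f0 b0 a0.
Qed.

Lemma pmf_anti k x y : 0 < x -> x <= y ->
  trunc_poisson_pmf k y k <= trunc_poisson_pmf k x k.
Proof.
move=> x0 xy; have y0 := lt_le_trans x0 xy.
rewrite /trunc_poisson_pmf !gt_eqF // leqnn.
have b0 : 0 < k`!%:R :> R by rewrite ltr0n fact_gt0.
rewrite ler_pdivrMr ?mulr_gt0 ?f_gt0 // mulrAC ler_pdivlMr ?mulr_gt0 ?f_gt0 //.
rewrite mulrCA [leRHS]mulrCA ler_pM2l // f_ratio_le //.
Qed.

Lemma pmf_le1 k x : 0 < x -> trunc_poisson_pmf k x k <= 1.
Proof.
move=> x0; rewrite /trunc_poisson_pmf gt_eqF // leqnn.
have b0 : 0 < k`!%:R :> R by rewrite ltr0n fact_gt0.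
rewrite ler_pdivrMr ?mulr_gt0 ?f_gt0 // mul1r mulrC -ler_pdivrMr //.
exact/f_ge_term/ltW.
Qed.

(* The case analysis avoids proving that the root defining [lambda k c] exists:
   where it does not, the junk value 0 stands for the point mass at k, for which
   the inequality still holds. *)
Lemma ck'_le_pmf k c : (1 < k)%N -> 0 <= c -> c < ck' R k ->
  ck' R k <= (k * k.-1)%:R * trunc_poisson_pmf k (lambda k c) k.
Proof.
move=> k1 c0 c_lt; have muN0 : mu_ck R k != 0.
  apply: contraTneq c_lt => mu0; rewrite -leNgt /ck' mu0 !mul0r //.
have [mu0 _] := mu_ck_root k1 muN0.
rewrite {1}ck'E // ler_wpM2l //.
have [l0|lN0] := eqVneq (lambda k c) 0.
  by rewrite l0 {2}/trunc_poisson_pmf !eqxx pmf_le1.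
have [l0 lc] : 0 < lambda k c /\
    lambda k c * f_ k.-1 (lambda k c) / f_ k (lambda k c) = c.
  by move: lN0; rewrite /lambda; case: xgetP => [l _ [? ?]|_ /eqP].
have [le_mu|lt_mu] := leP (lambda k c) (mu_ck R k); first exact: pmf_anti.
(* A parameter above [mu_ck R k] would have mean at least [ck' R k], but its mean is [c]. *)
case/negP: (negbT (ltxx c)); apply: lt_le_trans c_lt _.
rewrite -lc /ck' ler_pdivrMr ?f_gt0 // mulrAC ler_pdivlMr ?f_gt0 //.
case: k k1 {lc muN0 l0 lN0 c0} mu0 lt_mu => [//|k] _ mu0 lt_mu.
exact: f_mean_le (ltW lt_mu).
Qed.

End TruncatedExponential.

(** * From the degree hypothesis to the theorem *)

Lemma expectation_num_deg (R : realType) disp (Omega : measurableType disp)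
    (P : probability Omega R) (n : nat) (Y : 'I_n -> {RV P >-> nat}) k (x : R) :
  iid_trunc_poisson Y k x ->
  ('E_P[fun w => ((num_deg k (fun i => Y i w))%:R : R)] =
    (n%:R * trunc_poisson_pmf k x k)%:E)%E.
Proof.
case=> _ pmfY; rewrite unlock.
pose A i := Y i @^-1` [set k].
have mA i : measurable (A i).
  by rewrite -[A i]setTI; exact: (measurable_funPT (Y i)).
transitivity (\int[P]_w (\sum_(i <- index_enum 'I_n) (\1_(A i) w)%:E))%E.
  apply: eq_integral => w _; rewrite sumEFin; congr (_%:E).
  rewrite /num_deg -sum1_card natr_sum big_mkcond /=; apply: eq_bigr => i _.
  rewrite inE indicE /A; case: eqP => [e|ne]; first by rewrite mem_set.
  by rewrite memNset.
rewrite ge0_integral_sum //=; last 1 first.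
  by move=> i; apply/measurable_realfun.measurable_EFinP; exact: measurable_realfun.measurable_indic.
rewrite (eq_bigr (fun=> (trunc_poisson_pmf k x k)%:E)); last first.
  by move=> i _; rewrite integral_indic // setIT; exact: pmfY.
rewrite sumEFin; congr (_%:E).
by rewrite sumr_const card_ord mulr_natl.
Qed.

(** The choice of [eta] turns the additive gap [eps] into [(1 + eta) * a <= ck' R k] for the average
    degree [a]; then [(1 + eta) * (1 - eta / 4) >= 1 + eta / 2] absorbs [phi]. *)
Lemma many_degree_k (R : realType) (k n m : nat) (eps eta phi : R) (d : 'I_n -> nat) :
  (2 < k)%N -> 0 < eps -> 0 < eta <= 1 -> eta <= eps / (1 + `|ck' R k|) ->
  k%:R <= avg_deg R n m <= ck' R k - eps -> phi <= eta / 4 ->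
  n%:R * trunc_poisson_pmf k (lambda k (avg_deg R n m)) k * (1 - phi) <=
    (num_deg k d)%:R ->
  (n <= m)%N /\
  (1 + eta / 4 + eta / 4) * (2 * m)%:R <= (k.-1 * (k * num_deg k d))%:R :> R.
Proof.
move=> k3 eps0 /andP[eta0 eta1] eta_le /andP[k_le le_ck] phi_le deg_ge.
have k0 : 0 < k%:R :> R by rewrite ltr0n; apply: ltn_trans k3.
have n0 : 0 < n%:R :> R.
  rewrite ltr0n lt0n; apply: contraTneq k_le => n0.
  by rewrite /avg_deg n0 invr0 mulr0 -ltNge.
have avgE : avg_deg R n m * n%:R = (2 * m)%:R by rewrite divfK // lt0r_neq0.
split.
  have : 3 * n%:R <= (2 * m)%:R :> R.
    rewrite -avgE ler_pM2r //; apply: le_trans k_le.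
    by rewrite (ler_nat R 3).
  by rewrite -natrM ler_nat; lia.
set c := ck' R k in eta_le le_ck; set a := avg_deg R n m in k_le le_ck deg_ge avgE.
have a0 : 0 <= a by apply: le_trans k_le; apply: ltW.
have c_gt : a < c by lra.
have c0 : 0 < c by lra.
rewrite gtr0_norm // ler_pdivlMr in eta_le; last by lra.
have := ck'_le_pmf (ltn_trans (isT : 1 < 2)%N k3) a0 c_gt.
rewrite -/c; set q := trunc_poisson_pmf _ _ _ in deg_ge * => q_ge.
have ac : (1 + eta) * a <= c by nra.
have phi1 : 0 <= 1 - phi by lra.
have mid : (1 + eta / 4 + eta / 4) * a <= c * (1 - phi).
  apply: (@le_trans _ _ ((1 + eta) * a * (1 - eta / 4))).
    rewrite mulrAC ler_wpM2r //; nra.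
  by apply: ler_pM => //; [rewrite mulr_ge0 // addr_ge0 // ltW | lra | lra].
rewrite -avgE mulrA; apply: le_trans (ler_wpM2r (ltW n0) mid) _.
rewrite mulnA [(k.-1 * k)%N]mulnC (natrM _ (k * k.-1)).
apply: le_trans (ler_wpM2l (ler0n _ _) deg_ge).
have -> : (k * k.-1)%:R * (n%:R * q * (1 - phi)) =
    (k * k.-1)%:R * q * (n%:R * (1 - phi)) by ring.
have -> : c * (1 - phi) * n%:R = c * (n%:R * (1 - phi)) by ring.
by rewrite ler_wpM2r // mulr_ge0.
Qed.

Theorem theorem8 (R : realType) (k : nat) (eps : R)
    (hk : (3 <= k)%N) (heps : 0 < eps) :
  exists2 eps' : R, 0 < eps' &
  forall (S : set nat) (m : nat -> nat) (d : forall n : nat, 'I_n -> nat)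
    (phi : nat -> R)
    (disp : measure_display) (Omega : measurableType disp)
    (P : probability Omega R) (Y : forall n : nat, 'I_n -> {RV P >-> nat}),
  (forall n, S n -> k%:R <= avg_deg R n (m n) <= ck' R k - eps) ->
  phi @ \oo --> (0 : R) ->
  (forall n, S n -> degree_seq k (m n) (d n)) ->
  (forall n, S n ->
     iid_trunc_poisson (Y n) k (lambda k (avg_deg R n (m n)))) ->
  (forall n, S n ->
     ('E_P[fun w => ((num_deg k (fun i => Y n i w))%:R : R)]
        * (1 - phi n)%:E <= ((num_deg k (d n))%:R)%:E)%E) ->
  (forall h : nat -> R, h @ \oo --> +oo ->
     prob_W R k (d n)
       (fun w => (w%:R <= h n) || (eps' * n%:R <= w%:R)) @[n --> within S \oo]
     --> (1 : R))
  /\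
  (exists2 delta : R, 0 < delta &
     \forall n \near within S \oo,
       delta <= prob_W R k (d n) (fun w => eps' * n%:R <= w%:R)).
Proof.
pose eta : R := Num.min 1 (eps / (1 + `|ck' R k|)).
have eta0 : 0 < eta.
  by rewrite lt_min ltr01 divr_gt0 // ltr_wpDr // normr_ge0.
have eta1 : eta <= 1 by rewrite ge_min lexx.
have eta_le : eta <= eps / (1 + `|ck' R k|) by rewrite ge_min lexx orbT.
have eta01 : 0 < eta <= 1 by rewrite eta0.
have eta4 : 0 < eta / 4 <= 1 by apply/andP; split; lra.
have [eps' [theta [rho [N0 [e0 /andP[t0 t1] /andP[p0 p1] bounds]]]]] :=
  prob_W_bounds hk eta4.
exists eps' => // S m d phi disp Omega P Y avg phi0 deg iid deg_k.
pose good n := degree_seq k (m n) (d n) /\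
  [/\ (0 < m n)%N, forall T, prob_W R k (d n)
          (fun w => (T.*2 <= w)%N && (w%:R < eps' * n%:R)) <= rho ^+ T.-1 &
       prob_W R k (d n) (fun w => w%:R < eps' * n%:R) <= 1 - (1 - theta) / k.-1%:R].
have near_good : \forall n \near \oo, S n -> good n.
  near=> n => Sn; split; first exact: deg.
  have phi_le : phi n <= eta / 4.
    near: n; apply: (cvgr_le (0 : R)) => //; lra.
  have n_ge : (N0.+1 <= n)%N by near: n; exact: nbhs_infty_ge.
  have := deg_k n Sn; rewrite (expectation_num_deg (iid n Sn)) -EFinM lee_fin.
  case/(many_degree_k hk heps eta01 eta_le (avg n Sn) phi_le) => nm degk.
  split; first by apply: leq_trans nm; apply: leq_trans n_ge.
    by case: (bounds n (m n) (d n)) => //; [rewrite (ltnW n_ge) | exact: deg].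
  by case: (bounds n (m n) (d n)) => //; [rewrite (ltnW n_ge) | exact: deg].
split=> [h hoo|].
  apply/cvgrPdist_le => e e_gt0.
  (* [T] is fixed by [e] alone; once [h n] passes [2 * (T + 1)], the gap event has probability at
     most [rho ^+ T]. *)
  have [T rhoT] : exists T, rho ^+ T <= e.
    have : rho ^+ T @[T --> \oo] --> (0 : R).
      by apply: cvg_expr; rewrite gtr0_norm.
    by move=> /(cvgr_le _)/(_ e e_gt0)[T _ /(_ T (leqnn T))]; exists T.
  have h_ge : \forall n \near \oo, T.+1.*2%:R <= h n.
    by move/cvgryPge: hoo; apply.
  rewrite near_withinE; near=> n => Sn.
  have [[sum_d kd] [m_gt0 gap _]] : good n by move: Sn; near: n; exact: near_good.
  rewrite (prob_WC R k sum_d m_gt0) opprB addrC subrK ger0_norm; last first.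
    exact: prob_W_ge0 sum_d _.
  apply: le_trans rhoT; apply: le_trans (gap T.+1); apply: (prob_W_homo R k sum_d).
  move=> w /=; rewrite negb_or -!ltNge => /andP[hw ->]; rewrite andbT.
  rewrite -(ler_nat R); apply: le_trans (ltW hw).
  by near: n; exact: h_ge.
exists ((1 - theta) / k.-1%:R).
  by rewrite divr_gt0 ?subr_gt0 // ltr0n; rewrite -subn1 subn_gt0 ltnW.
rewrite near_withinE; apply: filterS near_good => n gd Sn.
have [[sum_d kd] [m_gt0 _ lt]] := gd Sn.
rewrite (prob_WC R k sum_d m_gt0) lerBrDr addrC -lerBrDr; apply: le_trans lt.
by apply: (prob_W_homo R k sum_d) => w /=; rewrite -ltNge.
Unshelve. all: by end_near. Qed.
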